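(* Let $A$ be a nonzero commutative ring, $k\ge1$, and suppose the shape $\vec s=(n_1,\dots,n_k)$ is constant, $n_a=n+1$ for all $a$ (where $n\ge 0$), so that $M_a(p)=p$ for all $a$, i.e. $I_p=[p]^k$. For $X_\bullet=X_\bullet(\vec s;A)$ the diagonal simplicial tensor module, the ranks of the components of the Moore complex in degree $p\ge0$ are $$\operatorname{rank}Z_p(N_\bullet)=(p+1)!\,S(k,p+1),\qquad \operatorname{rank}N_p(X)=p!\,S(k,p)+(p+1)!\,S(k,p+1),$$ where $S(k,m)$ denotes the Stirling number of the second kind.
   Context: $[p]=\{0,\dots,p\}$. In the constant shape case the diagonal simplicial tensor module is the simplicial $A$-module with $X_p=A^{[p]^k}$ (all functions $T:[p]^k\to A$), in which a nondecreasing map $\alpha:[p]\to[q]$ acts by $X_q\to X_p$, $T\mapsto T\circ(\alpha\times\cdots\times\alpha)$; in particular the face $d_i:X_p\to X_{p-1}$ is precomposition with the $k$-fold product of the increasing injection $[p-1]\to[p]$ missing $i$. The normalized (Moore) complex is $N_p(X)=\bigcap_{i=1}^p\ker(d_i:X_p\to X_{p-1})$ (with $N_0=X_0$) with differential $d_0:N_p\to N_{p-1}$, and $Z_p(N_\bullet)=\ker(d_0:N_p\to N_{p-1})$, which equals $\bigcap_{i=0}^p\ker d_i$ for $p\ge1$; in degree $0$ one has $X_{-1}=0$, so $Z_0(N_\bullet)=X_0$. *)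

(* Defs.v *)
From HB Require Import structures.
From mathcomp Require Import all_boot all_order all_algebra.

Set Implicit Arguments.
Unset Strict Implicit.
Unset Printing Implicit Defensive.

Import Order.TTheory GRing.Theory.
Local Open Scope ring_scope.

(* The ordinal [p] = {0, ..., p} is 'I_p.+1. *)

Record simplicialModule (A : nzRingType) := SimplicialModule {
  smod_obj :> nat -> lmodType A;
  smod_map : forall p q : nat, {omorphism 'I_p.+1 -> 'I_q.+1} ->
    {linear smod_obj q -> smod_obj p};
  smod_map_id : forall (p : nat) (x : smod_obj p),
    smod_map (idfun : {omorphism 'I_p.+1 -> 'I_p.+1}) x = x;
  smod_map_comp : forall (p q r : nat)
      (beta : {omorphism 'I_q.+1 -> 'I_r.+1})
      (alpha : {omorphism 'I_p.+1 -> 'I_q.+1}) (x : smod_obj r),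
    smod_map (beta \o alpha : {omorphism 'I_p.+1 -> 'I_r.+1}) x =
    smod_map alpha (smod_map beta x)
}.

(* The increasing injection [p] -> [p + 1] missing i. *)
Definition coface (p : nat) (i : 'I_p.+2) : 'I_p.+1 -> 'I_p.+2 := lift i.

Fact coface_nondecreasing (p : nat) (i : 'I_p.+2) :
  {homo coface i : j l / (j <= l)%O}.
Proof. by move=> j l; rewrite !leEord /= leq_bump2. Qed.

HB.instance Definition _ (p : nat) (i : 'I_p.+2) :=
  Order.isOrderMorphism.Build _ 'I_p.+1 _ 'I_p.+2 (coface i)
    (@coface_nondecreasing p i).

Section Moore.
Variables (A : nzRingType) (X : simplicialModule A).

Definition face (p : nat) (i : 'I_p.+2) : {linear X p.+1 -> X p} :=
  smod_map X (coface i : {omorphism 'I_p.+1 -> 'I_p.+2}).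

Definition moore (p : nat) : {pred X p} :=
  match p with
  | 0 => predT
  | p'.+1 => [pred x | [forall i : 'I_p'.+2, (i != ord0) ==> (face i x == 0)]]
  end.

(* Since X_{-1} = 0, every element of N_0 is a cycle. *)
Definition moore_cycles (p : nat) : {pred X p} :=
  match p with
  | 0 => @moore 0
  | p'.+1 => [pred x | (x \in @moore p'.+1) && (face ord0 x == 0)]
  end.

End Moore.

Arguments moore {A} X p _.
Arguments moore_cycles {A} X p _.

(* S is a free submodule having a basis with r elements. *)
Definition free_of_rank (A : nzRingType) (V : lmodType A) (S : {pred V})
    (r : nat) : Prop :=
  exists b : 'I_r -> V,
    (forall v, v \in S <-> exists c : 'I_r -> A, v = \sum_(i < r) c i *: b i)
    /\ (forall c : 'I_r -> A,
          \sum_(i < r) c i *: b i = 0 -> forall i, c i = 0).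

(* Over a nonzero commutative ring the rank is unique. *)
Lemma free_of_rank_inj (A : comNzRingType) (V : lmodType A) (S : {pred V})
    (r s : nat) :
  free_of_rank S r -> free_of_rank S s -> r = s.
Proof.
suff le m n : free_of_rank S m -> free_of_rank S n -> (m <= n)%N.
  by move=> Sr Ss; apply/eqP; rewrite eqn_leq !le.
move=> [b [bS bI]] [d [dS _]].
have bin i : b i \in S.
  apply/bS; exists (fun j => (j == i)%:R).
  rewrite (bigD1 i) //= eqxx scale1r big1 ?addr0 // => j /negbTE->.
  by rewrite scale0r.
have din i : d i \in S.
  apply/dS; exists (fun j => (j == i)%:R).
  rewrite (bigD1 i) //= eqxx scale1r big1 ?addr0 // => j /negbTE->.
  by rewrite scale0r.
have /fin_all_exists [P PE] i := (dS (b i)).1 (bin i).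
have /fin_all_exists [Q QE] j := (bS (d j)).1 (din j).
apply: (@mulmx1_min A _ _ (\matrix_(i, j) P i j) (\matrix_(j, i) Q j i)).
apply/matrixP=> i l; rewrite !mxE.
apply/eqP; rewrite -subr_eq0; apply/eqP; move: l.
apply: bI; under eq_bigr do rewrite scalerBl; rewrite sumrB; apply/eqP.
rewrite subr_eq0; apply/eqP; transitivity (b i).
  under eq_bigr do rewrite scaler_suml; rewrite exchange_big /= [RHS]PE.
  apply: eq_bigr => j _; rewrite QE scaler_sumr.
  by apply: eq_bigr => l _; rewrite !mxE scalerA.
rewrite (bigD1 i) //= eqxx scale1r big1 ?addr0 // => l.
by rewrite eq_sym => /negbTE->; rewrite scale0r.
Qed.

Section DiagonalTensor.
Variables (A : comNzRingType) (k : nat).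

Definition cube (p : nat) := {ffun 'I_k -> 'I_p.+1}.

Definition cube_map (p q : nat) (alpha : 'I_p.+1 -> 'I_q.+1) (u : cube p) :
  cube q := [ffun a => alpha (u a)].

Definition tensor (p : nat) : lmodType A := {ffun cube p -> A^o}.

Definition tensor_map (p q : nat) (alpha : 'I_p.+1 -> 'I_q.+1) (T : tensor q) :
  tensor p := [ffun u => T (cube_map alpha u)].

Fact tensor_map_is_linear (p q : nat) (alpha : 'I_p.+1 -> 'I_q.+1) :
  linear (tensor_map alpha).
Proof. by move=> c T U; apply/ffunP=> u; rewrite !ffunE. Qed.

HB.instance Definition _ (p q : nat) (alpha : 'I_p.+1 -> 'I_q.+1) :=
  GRing.isLinear.Build A (tensor q) (tensor p) *:%R (tensor_map alpha)
    (@tensor_map_is_linear p q alpha).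

Fact tensor_map_id (p : nat) (T : tensor p) : tensor_map idfun T = T.
Proof.
apply/ffunP=> u; rewrite ffunE; congr (T _).
by apply/ffunP=> a; rewrite ffunE.
Qed.

Fact tensor_map_comp (p q r : nat) (beta : 'I_q.+1 -> 'I_r.+1)
    (alpha : 'I_p.+1 -> 'I_q.+1) (T : tensor r) :
  tensor_map (beta \o alpha) T = tensor_map alpha (tensor_map beta T).
Proof.
apply/ffunP=> u; rewrite !ffunE; congr (T _).
by apply/ffunP=> a; rewrite !ffunE.
Qed.

(* The diagonal simplicial tensor module of a constant shape (n+1, ..., n+1);
   it does not depend on n, since I_p = [p]^k. *)
Definition diagonal_tensor : simplicialModule A :=
  @SimplicialModule A tensor
    (fun p q (alpha : {omorphism 'I_p.+1 -> 'I_q.+1}) => tensor_map alpha)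
    (fun p => @tensor_map_id p)
    (fun p q r beta alpha => @tensor_map_comp p q r beta alpha).

End DiagonalTensor.

(* The number of partitions of a k-element set into m nonempty blocks. *)
Definition stirling2 (k m : nat) : nat :=
  #|[set P : {set {set 'I_k}} | partition P [set: 'I_k] & #|P| == m]|.

(* Main.v *)
Require Import Defs.
From mathcomp Require Import all_boot all_order all_algebra.

(* A face d_i is restriction to the maps [k] -> [p] that miss i. So N_p consists
   of the tensors supported on the maps whose image contains {1, ..., p}, and
   Z_p of those supported on the surjections: both are free on their supports.
   A surjection is a bijection from its codomain to the blocks of a partition of
   its domain (the fibers), so p! S(k,p) maps have image exactly {1, ..., p} and
   (p+1)! S(k,p+1) maps are surjective. *)

Set Implicit Arguments.
Unset Strict Implicit.
Unset Printing Implicit Defensive.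

Import GRing.Theory.

Section Surjections.
Variables (T D : finType).

Definition fibers (f : {ffun T -> D}) : {ffun D -> {set T}} :=
  [ffun j => f @^-1: [set j]].

Lemma in_fibers (f : {ffun T -> D}) j x : (x \in fibers f j) = (f x == j).
Proof. by rewrite ffunE !inE. Qed.

Lemma fibers_inj : injective fibers.
Proof.
move=> f g fg; apply/ffunP=> x; apply/eqP.
by rewrite eq_sym -in_fibers -fg in_fibers.
Qed.

(** Surjectivity makes every fiber nonempty, so distinct points of [D] have distinct fibers and
    [set0] is not a block. Conversely, an injective labelling [g] of the blocks of a partition by
    [D] comes from the map sending [x] to the label of its block. *)
Lemma fibers_surj : fibers @: [set f : {ffun T -> D} | f @: setT == setT] =
  [set g : {ffun D -> {set T}} | injectiveb g & partition (g @: setT) setT].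
Proof.
apply/setP=> g; rewrite inE; apply/imsetP/andP.
  case=> f; rewrite inE => /eqP fT ->.
  have fS j : exists x, f x = j.
    have : j \in f @: setT by rewrite fT.
    by case/imsetP=> x _ ->; exists x.
  split.
    apply/injectiveP=> i j ij; have [x fx] := fS i.
    by have := in_fibers f j x; rewrite -ij in_fibers fx eqxx => /esym/eqP.
  apply/and3P; split.
  - rewrite cover_imset; apply/eqP/setP=> x; rewrite inE.
    by apply/bigcupP; exists (f x); rewrite ?in_fibers.
  - apply/trivIsetP=> _ _ /imsetP[i _ ->] /imsetP[j _ ->] ij.
    rewrite disjoints_subset; apply/subsetP=> x; rewrite inE !in_fibers.
    by move=> /eqP fx; apply: contraNneq ij => <-; rewrite fx.
  - apply/imsetP=> -[j _ f0]; have [x fx] := fS j.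
    by have := in_fibers f j x; rewrite -f0 fx eqxx inE.
move=> [/injectiveP gI /and3P[/eqP gC /trivIsetP gD g0]].
have /fin_all_exists [f fE] x : exists j, x \in g j.
  have: x \in cover (g @: setT) by rewrite gC.
  by rewrite cover_imset => /bigcupP[j _ xj]; exists j.
(* The chosen label is unique: for [j] different from [f x], injectivity of [g] makes [g j] and
   [g (f x)] distinct blocks, hence disjoint, and they cannot share [x]. *)
have gE j x : (x \in g j) = (f x == j).
  apply/idP/eqP=> [xj | <- //]; apply/eqP/contraT=> /eqP ne.
  have /gD : g (f x) \in g @: setT by apply: imset_f.
  move/(_ (g j) (imset_f _ (in_setT _))).
  rewrite (inj_eq gI) => /(_ (introN eqP ne)).
  by rewrite disjoints_subset => /subsetP/(_ x (fE x)); rewrite inE xj.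
exists (finfun f); last first.
  by apply/ffunP=> j; apply/setP=> x; rewrite in_fibers ffunE gE.
rewrite inE; apply/eqP/setP=> j; rewrite inE.
have: g j != set0.
  by apply: contraNneq g0 => <-; apply: imset_f.
case/set0Pn=> x; rewrite gE => /eqP <-.
by apply/imsetP; exists x; rewrite ?ffunE.
Qed.

(** The labelled partitions are grouped by their underlying partition [P]; each [P] with [#|D|]
    blocks has [#|D|!] labellings. *)
Lemma card_surj : #|[set f : {ffun T -> D} | f @: setT == setT]| =
  #|D|`! * #|[set P : {set {set T}} | partition P setT & #|P| == #|D|]|.
Proof.
rewrite -(card_imset _ fibers_inj) fibers_surj -sum1_card.
set Ps := [set P : {set {set T}} | _ & _].
rewrite (partition_big (fun g : {ffun D -> {set T}} => g @: setT)
           (fun P => P \in Ps)) /=.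
  rewrite mulnC -sum_nat_const; apply: eq_bigr => P.
  rewrite inE => /andP[PT /eqP PD].
  (* The factorial is read as the falling factorial [#|P| ^_ #|D|], which counts the injections from
     [D] into [P]. *)
  rewrite sum1dep_card -ffactnn -{1}PD -card_inj_ffuns_on.
  apply: eq_card => g; rewrite !inE.
  have [/injectiveP gI|] := boolP (injectiveb g); rewrite ?andbF //= andbT.
  apply/andP/ffun_onP=> [[_ /eqP <-] j | gP]; first exact: imset_f.
  (* An injection between finite sets of equal cardinality is onto. *)
  suff gE : g @: setT = P by rewrite gE eqxx.
  apply/eqP; rewrite eqEcard card_imset // cardsT PD leqnn andbT.
  by apply/subsetP=> _ /imsetP[j _ ->].
move=> g; rewrite !inE => /andP[/injectiveP gI ->] /=.
by rewrite card_imset // cardsT.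
Qed.

End Surjections.

Lemma card_surj_ord k m :
  #|[set f : {ffun 'I_k -> 'I_m} | f @: setT == setT]| = m`! * stirling2 k m.
Proof. by rewrite card_surj card_ord. Qed.

(** Maps avoiding 0 factor uniquely through [lift ord0], a bijection from ['I_p] onto the nonzero
    elements, so these are the surjections onto ['I_p] in disguise. *)
Lemma card_onto_setC0 k p :
  #|[set f : {ffun 'I_k -> 'I_p.+1} | f @: setT == [set~ ord0]]| =
  p`! * stirling2 k p.
Proof.
pose h (f : {ffun 'I_k -> 'I_p}) := [ffun x => lift ord0 (f x)].
have hI : injective h.
  move=> f g /ffunP fg; apply/ffunP=> x; apply: (@lift_inj _ ord0).
  by have := fg x; rewrite !ffunE.
rewrite -card_surj_ord -(card_imset _ hI); apply: eq_card => g.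
have liftE (f : {ffun 'I_k -> 'I_p}) : h f @: setT = lift ord0 @: (f @: setT).
  by rewrite -imset_comp; apply: eq_imset => x; rewrite ffunE.
have liftT : lift ord0 @: [set: 'I_p] = [set~ ord0].
  apply/setP=> i; rewrite !inE; apply/imsetP/idP=> [[j _ ->] //|].
  by rewrite eq_sym => /unlift_some[j -> _]; exists j.
rewrite inE; apply/eqP/imsetP=> [gT | [f]]; last first.
  by rewrite inE => /eqP fT ->; rewrite liftE fT.
have /fin_all_exists [f fE] x : exists j, g x = lift ord0 j.
  have : g x \in [set~ ord0] by rewrite -gT imset_f.
  by rewrite !inE eq_sym => /unlift_some[j -> _]; exists j.
have gE : g = h (finfun f) by apply/ffunP=> x; rewrite !ffunE.
exists (finfun f) => //; rewrite inE; apply/eqP/(imset_inj (@lift_inj _ ord0)).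
by rewrite -liftE -gE gT liftT.
Qed.

Lemma card_onto_ge1 k p :
  #|[set f : {ffun 'I_k -> 'I_p.+1} | [set~ ord0] \subset f @: setT]| =
  p`! * stirling2 k p + p.+1`! * stirling2 k p.+1.
Proof.
rewrite -card_onto_setC0 -card_surj_ord -cardsUI.
(* An image containing all nonzero elements is either exactly their set or everything, according to
   whether it contains 0; the two cases exclude each other. *)
rewrite [X in _ + #|pred_of_set X|](_ : _ = set0) ?cards0 ?addn0.
  apply: eq_card => f; rewrite !inE; set B := f @: setT.
  apply/idP/orP=> [sB | [] /eqP-> //]; rewrite !eqEsubset sB subsetT andbT /=.
  have [B0|B0] := boolP (ord0 \in B); [right | left]; apply/subsetP=> i.
    have [-> //|i0] := eqVneq i ord0.
    by move=> _; apply: (subsetP sB); rewrite !inE.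
  by move=> iB; rewrite !inE; apply: contraNneq B0 => <-.
apply/setP=> f; rewrite !inE; apply/andP=> -[/eqP-> /eqP/setP/(_ ord0)].
by rewrite !inE eqxx.
Qed.

Local Open Scope ring_scope.

(** The basis consists of the indicator functions of the points of [S], and the coordinates of [T]
    are its values there. *)
Lemma free_of_rank_support (A : comNzRingType) (I : finType) (S : {set I})
    (M : {pred {ffun I -> A^o}}) :
  (forall T : {ffun I -> A^o},
     (T \in M) <-> (forall u, u \notin S -> T u = 0)) ->
  free_of_rank (V := {ffun I -> A^o}) M #|S|.
Proof.
move=> MS; exists (fun i => [ffun u => (u == enum_val i)%:R]).
have sumE (c : 'I_#|S| -> A) u :
    (\sum_i c i *: [ffun v => (v == enum_val i)%:R] : {ffun I -> A^o}) u =
    \sum_i c i * (u == enum_val i)%:R.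
  by rewrite sum_ffunE; apply: eq_bigr => i _; rewrite !ffunE.
have sum_val (c : 'I_#|S| -> A) j :
    \sum_i c i * (enum_val j == enum_val i)%:R = c j.
  rewrite (bigD1 j) //= eqxx mulr1 big1 ?addr0 // => i ij.
  by rewrite (inj_eq enum_val_inj) eq_sym (negbTE ij) mulr0.
split=> [T | c /ffunP c0 j]; last by rewrite -(sum_val c) -sumE c0 ffunE.
have sum_out (c : 'I_#|S| -> A) u : u \notin S ->
    \sum_i c i * (u == enum_val i)%:R = 0.
  move=> uS; apply: big1 => i _; case: eqP => [uE|]; last by rewrite mulr0.
  by rewrite uE enum_valP in uS.
split=> [/MS T0 | [c ->]]; last by apply/MS=> u uS; rewrite sumE sum_out.
exists (fun i => T (enum_val i)); apply/ffunP=> u; rewrite sumE.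
have [uS|uS] := boolP (u \in S); last by rewrite T0 // sum_out.
by rewrite -(enum_rankK_in uS uS) (sum_val (fun i => T (enum_val i))).
Qed.

Section DiagonalTensorMoore.
Variables (A : comNzRingType) (k : nat).
Local Notation X := (diagonal_tensor A k).

(** The maps that miss [i] are exactly the composites of some [v] with the coface [lift i], and the
    face evaluates [T] at these. *)
Lemma face_eq0P p (i : 'I_p.+2) (T : X p.+1) :
  reflect (forall u : cube k p.+1, i \notin u @: setT ->
             (T : {ffun _ -> A^o}) u = 0)
    (@face A X p i T == 0).
Proof.
apply: (iffP eqP) => [/ffunP dT0 u iu | T0].
  have /fin_all_exists [v vE] a : exists j, u a = lift i j.
    have : i != u a by apply: contraNneq iu => ->; rewrite imset_f.
    by case/unlift_some=> j -> _; exists j.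
  have := dT0 (finfun v); rewrite !ffunE => <-; congr (T _).
  by apply/ffunP=> a; rewrite !ffunE.
apply/ffunP=> v; rewrite !ffunE T0 //; apply/imsetP=> -[a _ /eqP].
by rewrite ffunE; apply/negP/neq_lift.
Qed.

Lemma mem_moore p (T : X p) :
  T \in moore X p <->
  (forall u : cube k p, ~~ ([set~ ord0] \subset u @: setT) ->
     (T : {ffun _ -> A^o}) u = 0).
Proof.
case: p T => [|p] T.
  (* In degree 0 the set [[set~ ord0]] is empty, so the support condition is vacuous, matching
     [N_0 = X_0]. *)
  by split=> // _ u /subsetP[] i; rewrite !inE ord1 eqxx.
rewrite inE; split=> [/forallP T0 u /subsetPn[i] | T0].
  by rewrite !inE => i0; apply/face_eq0P; apply: implyP (T0 i) i0.
apply/forallP=> i; apply/implyP=> i0; apply/face_eq0P=> u iu; apply: T0.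
by apply/subsetPn; exists i; rewrite ?inE.
Qed.

Lemma mem_moore_cycles p (T : X p) : (0 < k)%N ->
  T \in moore_cycles X p <-> (forall u : cube k p, u @: setT != setT ->
                                (T : {ffun _ -> A^o}) u = 0).
Proof.
case: p T => [|p] T k_gt0.
  (* In degree 0 every tensor is a cycle, so every map to [[0]] must be surjective; this is where
     [k] has to be positive. *)
  split=> // _ u /eqP[]; apply/setP=> i; rewrite inE [i]ord1.
  by apply/imsetP; exists (Ordinal k_gt0); rewrite ?[u _]ord1.
rewrite inE; split=> [/andP[/mem_moore T0 /face_eq0P dT0] u uT | T0].
  (* A non-surjective [u] either misses 0, and [d_0] kills its value, or misses a nonzero element,
     and the Moore condition does. *)
  have [u0|] := boolP (ord0 \in u @: setT); last exact: dT0.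
  apply: T0; apply: contraNN uT => sU; rewrite eqEsubset subsetT /=.
  apply/subsetP=> i _; have [-> //|i0] := eqVneq i ord0.
  by apply: (subsetP sU); rewrite !inE.
apply/andP; split; last first.
  by apply/face_eq0P=> u u0; apply: T0; apply: contraNneq u0 => ->.
by apply/mem_moore=> u uN; apply: T0; apply: contraNneq uN => ->.
Qed.

End DiagonalTensorMoore.

Local Close Scope ring_scope.

Theorem theorem5p6 (A : comNzRingType) (k : nat) (hk : (1 <= k)%N) (p : nat) :
  free_of_rank (moore_cycles (diagonal_tensor A k) p)
    (p.+1`! * stirling2 k p.+1)%N /\
  free_of_rank (moore (diagonal_tensor A k) p)
    (p`! * stirling2 k p + p.+1`! * stirling2 k p.+1)%N.
Proof.
split.
  rewrite -card_surj_ord; apply: free_of_rank_support => T.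
  split=> [/(mem_moore_cycles _ hk) T0 u | T0].
    by rewrite inE; apply: T0.
  by apply/(mem_moore_cycles _ hk)=> u uS; apply: T0; rewrite inE.
rewrite -card_onto_ge1; apply: free_of_rank_support => T.
split=> [/mem_moore T0 u | T0]; first by rewrite inE; apply: T0.
by apply/mem_moore=> u uS; apply: T0; rewrite inE.
Qed.
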